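(* Let $0<c<C<\infty$ and let $L,R:[0,\infty)\times\mathbb{R}\to\mathbb{R}$ satisfy: (i) for each $x\in\mathbb{R}$, $L(\cdot,x),R(\cdot,x)\in D[0,\infty)$; (ii) for each $t\ge 0$, $L(t,\cdot)$ and $R(t,\cdot)$ are strictly increasing; (iii) $c|x-y|\le |L(t,x)-L(t,y)|\le C|x-y|$ and $c|x-y|\le |R(t,x)-R(t,y)|\le C|x-y|$ for all $t\ge 0$, $x,y\in\mathbb{R}$; (iv) $\inf_{(t,x)\in[0,\infty)\times\mathbb{R}}(R(t,x)-L(t,x))>0$. Let $S,S'\in D[0,\infty)$ and let $(X,K)$, $(X',K')$ be the solutions of the Skorokhod problems $\mathbb{SP}_L^R(S)$ and $\mathbb{SP}_L^R(S')$, respectively. Then for every $T>0$, $$d_{0,T}(K,K')\le \frac{1}{c}\max(\hat{L}_T,\hat{R}_T)+\frac{C}{c}\,d_{0,T}(S,S'),$$ where $\hat{L}_T=\sup_{t,s\in[0,T],\,x\in\mathbb{R}}|L(t,x)-L(s,x)|$ and $\hat{R}_T=\sup_{t,s\in[0,T],\,x\in\mathbb{R}}|R(t,x)-R(s,x)|$ (values in $[0,\infty]$), and $d_{0,T}$ is the $J_1$ metric on $[0,T]$ applied to the restrictions of the functions to $[0,T]$.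
   Context: $D[0,\infty)$ is the set of real-valued right-continuous functions on $[0,\infty)$ with left limits; $BV[0,\infty)$ is the set of $K\in D[0,\infty)$ of bounded variation on each compact interval. $J_1$ metric: with $\mathcal{M}_T$ the set of strictly increasing continuous functions from $[0,T]$ onto itself, $d_{0,T}(f,g)=\inf_{\lambda\in\mathcal{M}_T}\max\left(\sup_{t\in[0,T]}|\lambda(t)-t|,\ \sup_{t\in[0,T]}|f_t-g_{\lambda(t)}|\right)$. Skorokhod problem $\mathbb{SP}_L^R(S)$: a pair $(X,K)\in D[0,\infty)\times BV[0,\infty)$ is a solution if (a) $X_t=S_t+K_t$ for all $t\ge0$; (b) $L(t,X_t)\le 0\le R(t,X_t)$ for all $t\ge 0$; (c) $K_{0-}=0$ and $K=K^r-K^l$, where $K^r,K^l$ are nondecreasing (right-continuous, with $K^r_{0-}=K^l_{0-}=0$) and $\int_0^\infty I_{\{L(s,X_s)<0\}}dK^l_s=0$, $\int_0^\infty I_{\{R(s,X_s)>0\}}dK^r_s=0$. The integrals are over $[0,\infty)$ including time $0$, where $dK^r,dK^l$ have atoms of mass $K^r_0,K^l_0$. Under hypotheses (i)–(iv), this problem has a unique solution, and in fact $$K_t=-\max\left((-\Phi_0)^+\wedge \inf_{r\in[0,t]}(-\Psi_r),\ \sup_{s\in[0,t]}\left[(-\Phi_s)\wedge \inf_{r\in[s,t]}(-\Psi_r)\right] \right),$$ where $\Phi_t,\Psi_t$ are the unique reals with $L(t,S_t+\Phi_t)=0$, $R(t,S_t+\Psi_t)=0$. *)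

(* Defs.v *)
From HB Require Import structures.
From mathcomp Require Import all_boot all_order all_algebra.
From mathcomp Require Import all_classical all_reals all_analysis.
Import Order.TTheory GRing.Theory Num.Theory.
Import numFieldNormedType.Exports.

Set Implicit Arguments.
Unset Strict Implicit.
Unset Printing Implicit Defensive.

Local Open Scope classical_set_scope.
Local Open Scope ring_scope.

(* A function on [0, +oo[ is represented by a function on R whose values at
   negative times are irrelevant: every notion below only constrains or reads
   the values at times t >= 0. *)

Definition cadlag (R : realType) (f : R -> R) : Prop :=
  (forall t : R, 0 <= t -> f x @[x --> t^'+] --> f t) /\
  (forall t : R, 0 < t -> cvg (f x @[x --> t^'-])).

Definition cadlag_bv (R : realType) (f : R -> R) : Prop :=
  cadlag f /\
  (forall a b : R, 0 <= a -> a <= b -> bounded_variation a b f).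

Definition time_change (R : realType) (T : R) : set (R -> R) :=
  [set lam : R -> R | [/\ {in `[0, T] &, {homo lam : s t / s < t}},
                 {within `[0, T]%classic, continuous lam} &
                 lam @` `[0, T]%classic = `[0, T]%classic ] ].

Definition J1_dist (R : realType) (T : R) (f g : R -> R) : \bar R :=
  ereal_inf [set
    maxe (ereal_sup [set (`|lam t - t|)%:E | t in `[0, T]%classic])
         (ereal_sup [set (`|f t - g (lam t)|)%:E | t in `[0, T]%classic])
    | lam in time_change T].

Definition time_osc (R : realType) (T : R) (F : R -> R -> R) : \bar R :=
  ereal_sup [set z : \bar R | exists t s x : R,
    [/\ t \in `[0, T], s \in `[0, T] & z = (`|F t x - F s x|)%:E]].

(* The Skorokhod problem for S with lower barrier function L and upper barrier
   function U. Kr and Kl are extended by 0 to negative times, which is the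
   convention K^r_{0-} = K^l_{0-} = 0 (hence K_{0-} = 0): monotonicity on R
   then gives Kr 0 >= 0 and Kl 0 >= 0, and the Lebesgue-Stieltjes measures have
   atoms of mass Kr 0 and Kl 0 at time 0, inside the integration domain. *)
Record skorokhod_solution (R : realType) (L U : R -> R -> R) (S X K : R -> R)
    : Prop := SkorokhodSolution {
  sk_cadlag : cadlag X ;
  sk_bv : cadlag_bv K ;
  sk_decomp : forall t : R, 0 <= t -> X t = S t + K t ;
  sk_barriers : forall t : R, 0 <= t -> L t (X t) <= 0 <= U t (X t) ;
  sk_minimal : exists Kr Kl : cumulative R R,
    [/\ forall t : R, t < 0 -> Kr t = 0 /\ Kl t = 0,
        forall t : R, 0 <= t -> K t = Kr t - Kl t,
        (\int[lebesgue_stieltjes_measure Kl]_(s in `[0%R, +oo[)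
           (\1_[set s : R | (L s (X s) < 0)%R] s)%:E = 0)%E &
        (\int[lebesgue_stieltjes_measure Kr]_(s in `[0%R, +oo[)
           (\1_[set s : R | (U s (X s) > 0)%R] s)%:E = 0)%E ]
}.

(* Main.v *)
(** Fix a time change [lam] with [|S t - S' (lam t)| <= d] on [[0, T]] and let
    [e] bound the oscillations of the barriers on [[0, T]].  As long as
    [K t - K' (lam t) > e / c + d], the lower Lipschitz bound forces
    [L (lam t) (X' (lam t)) < L t (X t) <= 0] and
    [0 <= U (lam t) (X' (lam t)) < U t (X t)], so neither [Kr] nor
    [Kl' \o lam] can move and [K - K' \o lam] can only decrease; hence it never
    exceeds [e / c + d].  The reverse difference is symmetric, and it remains to
    take the infimum over [lam], using [C / c >= 1]. *)

Require Import Defs.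
From HB Require Import structures.
From mathcomp Require Import all_boot all_order all_algebra.
From mathcomp Require Import all_classical all_reals all_analysis.
From mathcomp Require Import ring lra.
Import Order.TTheory GRing.Theory Num.Theory.
Import numFieldNormedType.Exports.

Local Open Scope classical_set_scope.
Local Open Scope ring_scope.

Set Implicit Arguments.
Unset Strict Implicit.
Unset Printing Implicit Defensive.

(** * Null sets and atoms of Lebesgue-Stieltjes measures *)

(* The monotonicity of the integral in the library needs both integrands to be
   measurable, but [A] need not be measurable. *)
Lemma measure0_integral_indic (d : measure_display) (X : measurableType d)
    (R : realType) (mu : {measure set X -> \bar R}) (D A B : set X) :
  measurable B -> B `<=` D `&` A ->
  (\int[mu]_(x in D) (\1_A x)%:E = 0)%E -> mu B = 0%E.
Proof.
move=> mB BDA; rewrite ge0_integralE; last by move=> x _; rewrite lee_fin.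
move=> int0; apply/eqP; rewrite eq_le measure_ge0 andbT -int0.
(* The integral is a supremum over simple functions below the integrand cut off outside [D]; the
   indicator of [B] is one of them. *)
apply: ereal_sup_ubound; exists (indic_nnsfun R mB) => /=.
  move=> x; rewrite patchE /= -[measurable_realfun.mindic _ _ x]/(\1_B x) indicE.
  have [xB|_] := boolP (x \in B).
    have [Dx Ax] := BDA _ (set_mem xB).
    by rewrite (mem_set Dx) indicE (mem_set Ax).
  by case: ifP => // _; rewrite lee_fin.
exact: sintegral_indic.
Qed.

Section stieltjes.
Context {R : realType} (f : cumulative R R).
Let mu := lebesgue_stieltjes_measure f.

Lemma lebesgue_stieltjes_itvoc (a b : R) : a <= b ->
  mu `]a, b]%classic = (f b - f a)%:E.
Proof.
move=> ab; rewrite /mu /lebesgue_stieltjes_measure /measure_extension/=.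
by rewrite measurable_mu_extE/= ?wlength_itv_bnd//; exact: is_ocitv.
Qed.

(** Continuity from above: the intervals []s - 1/(n+1), s]] decrease to [{s}], so their masses, the
    increments of [f], tend to 0. *)
Lemma lebesgue_stieltjes_set1_eq0 (s e : R) : 0 < e -> mu [set s] = 0%E ->
  exists2 s0, s0 < s & f s - f s0 < e.
Proof.
move=> e0 mus0.
pose F n := (`]s - n.+1%:R^-1, s]%classic : set (measurableTypeR R)).
have lts n : s - n.+1%:R^-1 < s by rewrite ltrBlDr ltrDl.
have muF n : mu (F n) = (f s - f (s - n.+1%:R^-1))%:E.
  by rewrite lebesgue_stieltjes_itvoc// ltW.
have capF : \bigcap_n F n = [set s].
  apply/seteqP; split => [x Fx|x -> n _]; last by rewrite /F/= in_itv/= lts lexx.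
  have : x \in `]s - 1%:R^-1, s] := Fx 0%N I; rewrite in_itv/= => /andP[_ xs].
  apply/eqP; rewrite eq_le xs/= leNgt; apply/negP => ltxs.
  have /ltr_add_invr[n] := ltxs.
  have : x \in `]s - n.+1%:R^-1, s] := Fx n I; rewrite in_itv/=.
  rewrite ltrBlDr => /andP[+ _].
  by move=> /lt_trans/[apply]; rewrite ltxx.
have : mu \o F @ \oo --> mu (\bigcap_n F n).
  apply: nonincreasing_cvg_mu => //.
  - by rewrite -[X in (X < _)%E]/(mu (F 0%N)) muF ltry.
  - by move=> i; exact: measurable_itv.
  - by rewrite capF.
  - move=> m n mn; apply/subsetPset/subset_itv; rewrite leBSide//= lerB//.
    by rewrite lef_pV2 ?posrE// ler_nat.
rewrite capF mus0 => /fine_cvgP[_ /cvgr_lt/(_ _ e0)[N _ /(_ N (leqnn N))]].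
rewrite /= -[X in fine X]/(mu (F N)) muF/= => ltN.
by exists (s - N.+1%:R^-1).
Qed.

End stieltjes.

(** * Monotone functions that do not charge a set *)

(* Says without measures that the Stieltjes measure of [k] on [[0, T]], with an
   atom of mass [k 0] at 0, does not charge [P]: neither the atom at 0, nor
   intervals contained in [P], nor the atoms at positive times. *)
Definition inert_on {R : realType} (T : R) (P : R -> Prop) (k : R -> R) :=
  [/\ P 0 -> k 0 <= 0,
      forall a b : R, 0 <= a -> a <= b -> b <= T ->
        (forall s : R, a < s -> s <= b -> P s) -> k b <= k a &
      forall s e : R, 0 < s -> s <= T -> P s -> 0 < e ->
        exists s0 : R, [/\ 0 <= s0, s0 < s & k s - k s0 < e]].

Lemma inert_on_cumulative {R : realType} (T : R) (P : R -> Prop)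
    (f : cumulative R R) :
  (forall t, t < 0 -> f t = 0) ->
  (\int[lebesgue_stieltjes_measure f]_(s in `[0%R, +oo[)
     (\1_[set s : R | P s] s)%:E = 0)%E ->
  inert_on T P f.
Proof.
move=> f0 int0.
have atom s e : 0 <= s -> P s -> 0 < e -> exists2 s0, s0 < s & f s - f s0 < e.
  move=> s0 Ps e0; apply: lebesgue_stieltjes_set1_eq0 => //.
  apply: measure0_integral_indic int0 => // _ ->; split => //=.
  by rewrite in_itv/= s0.
split.
(* Here the point to the left of 0 is a negative time, where [f] vanishes, so the increment is [f 0]
   itself. *)
- move=> P0; apply/ler_addgt0Pr => e e0; rewrite add0r.
  by have [s0 /f0-> /ltW] := atom 0 e (lexx _) P0 e0; rewrite subr0.
- move=> a b a0 ab _ Pab.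
  suff : (f b - f a)%:E = 0%E by move=> [/eqP]; rewrite subr_eq0 => /eqP->.
  rewrite -lebesgue_stieltjes_itvoc//.
  apply: measure0_integral_indic int0 => // x /=.
  rewrite in_itv/= => /andP[ax xb]; split; last exact: Pab.
  by rewrite in_itv/= andbT (le_trans a0) ?ltW.
- move=> s e s0 _ Ps e0; have [u us fsu] := atom s e (ltW s0) Ps e0.
  (* The witness must be nonnegative; moving it to the right only shrinks the increment. *)
  exists (Num.max u 0); rewrite le_max lexx orbT gt_max us s0; split => //.
  apply: le_lt_trans fsu; rewrite lerB//; apply: cumulative_is_nondecreasing.
  by rewrite le_max lexx.
Qed.

(** Used to treat the two terms that push a difference of solutions upwards as one function. At an
    atom each gets [e / 2], and by monotonicity the later witness serves both. *)
Lemma inert_onD {R : realType} (T : R) (P Q : R -> Prop) (k m : R -> R) :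
  {in `[0, T] &, {homo k : s t / s <= t}} ->
  {in `[0, T] &, {homo m : s t / s <= t}} ->
  inert_on T P k -> inert_on T Q m ->
  inert_on T (fun s => P s /\ Q s) (fun s => k s + m s).
Proof.
move=> kn mn [k0 kI kA] [m0 mI mA]; split.
- by move=> [/k0 k0' /m0 m0']; lra.
- move=> a b a0 ab bT PQ.
  by rewrite lerD// ?kI ?mI// => s sa sb; have [] := PQ s sa sb.
- move=> s e s0 sT [Ps Qs] e0; have e20 : 0 < e / 2 by rewrite divr_gt0.
  have [u [u0 us ku]] := kA s _ s0 sT Ps e20.
  have [v [v0 vs mv]] := mA s _ s0 sT Qs e20.
  have uT : u \in `[0, T] by rewrite in_itv/= u0 (le_trans (ltW us) sT).
  have vT : v \in `[0, T] by rewrite in_itv/= v0 (le_trans (ltW vs) sT).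
  have wT : Num.max u v \in `[0, T] by rewrite /Order.max; case: ifP.
  exists (Num.max u v); rewrite gt_max us vs le_max u0; split => //.
  have /kn := uT => /(_ _ wT); rewrite le_max lexx => /(_ isT) kw.
  have /mn := vT => /(_ _ wT); rewrite le_max lexx orbT => /(_ isT) mw.
  lra.
Qed.

(** * Time changes *)

Lemma time_change_in (R : realType) (T : R) (lam : R -> R) :
  time_change T lam -> forall t, t \in `[0, T] -> lam t \in `[0, T].
Proof.
case=> _ _ lamE t tT.
have : (lam @` `[0, T]%classic) (lam t) by exists t.
by rewrite lamE.
Qed.

Lemma time_change_surj (R : realType) (T : R) (lam : R -> R) :
  time_change T lam ->
  forall u, u \in `[0, T] -> exists2 t, t \in `[0, T] & lam t = u.
Proof.
case=> _ _ lamE u uT.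
have [t tT <-] : (lam @` `[0, T]%classic) u by rewrite lamE.
by exists t.
Qed.

Lemma time_change_le (R : realType) (T : R) (lam : R -> R) :
  time_change T lam -> {in `[0, T] &, {homo lam : s t / s <= t}}.
Proof.
case=> lam_incr _ _ s t sT tT; rewrite le_eqVlt => /predU1P[->//|st].
exact/ltW/lam_incr.
Qed.

Lemma time_change_lt (R : realType) (T : R) (lam : R -> R) :
  time_change T lam -> {in `[0, T] &, {mono lam : s t / s < t}}.
Proof.
move=> lamT s t sT tT; apply/idP/idP; last by case: lamT => + _ _; exact.
by apply: contraTT; rewrite -!leNgt; exact: (time_change_le lamT).
Qed.

(** A preimage [t] of 0 gives [lam 0 <= lam t = 0]. Hence time changes match the atoms at time 0. *)
Lemma time_change0 (R : realType) (T : R) (lam : R -> R) :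
  0 <= T -> time_change T lam -> lam 0 = 0.
Proof.
move=> T0 lamT.
have zT : 0 \in `[0, T] by rewrite in_itv/= lexx.
have [t tT lamt] := time_change_surj lamT zT.
have /andP[t0 _] : 0 <= t <= T by move: tT; rewrite in_itv.
have /andP[lam0 _] : 0 <= lam 0 <= T.
  by have := time_change_in lamT zT; rewrite in_itv.
apply/le_anti; rewrite lam0 andbT.
by have := time_change_le lamT zT tT t0; rewrite lamt.
Qed.

(** [inert_on] involves only order and values, so it is carried along an increasing bijection
    without image measures: points of []lam a, lam b]] and witnesses to the left of [lam s] are
    pulled back by surjectivity. *)
Lemma inert_on_time_change (R : realType) (T : R) (lam : R -> R)
    (P : R -> Prop) (k : R -> R) :
  0 <= T -> time_change T lam ->
  inert_on T P k -> inert_on T (P \o lam) (k \o lam).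
Proof.
move=> T0 lamT [k0 kI kA]; split => /=.
- by rewrite (time_change0 T0 lamT).
- move=> a b a0 ab bT Pab.
  have aT : a \in `[0, T] by rewrite in_itv/= a0 (le_trans ab).
  have bT' : b \in `[0, T] by rewrite in_itv/= bT (le_trans a0).
  have := time_change_in lamT aT; have := time_change_in lamT bT'.
  rewrite !in_itv/= => /andP[lb0 lbT] /andP[la0 laT].
  apply: kI => //; first exact: (time_change_le lamT).
  move=> u au ub.
  have [|s sT lams] := @time_change_surj _ _ _ lamT u.
    by rewrite in_itv/= (le_trans la0 (ltW au)) (le_trans ub).
  move: au ub; rewrite -lams (time_change_lt lamT)// leNgt (time_change_lt lamT)// -leNgt.
  exact: Pab.
- move=> s e s0 sT Ps e0.
  have zT : 0 \in `[0, T] by rewrite in_itv/= lexx.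
  have sT' : s \in `[0, T] by rewrite in_itv/= sT ltW.
  have := time_change_in lamT sT'; rewrite in_itv/= => /andP[_ lsT].
  have ls0 : 0 < lam s by rewrite -(time_change0 T0 lamT) (time_change_lt lamT).
  have [u [u0 us ku]] := kA _ _ ls0 lsT Ps e0.
  have [|v vT lamv] := @time_change_surj _ _ _ lamT u.
    by rewrite in_itv/= u0 (le_trans (ltW us)).
  exists v; rewrite lamv; split => //.
    by move: vT; rewrite in_itv => /andP[].
  by rewrite -(time_change_lt lamT vT)// lamv.
Qed.

(** * Excursions above a level and comparison of two solutions *)

(* Just above the level [B], [k - n] can only move downwards; so look at the
   start of the current excursion of [k - n] above [B]. *)
Lemma le_of_inert_on {R : realType} (T B : R) (P : R -> Prop) (k n : R -> R) :
  0 <= B -> inert_on T P k ->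
  {in `[0, T] &, {homo k : s t / s <= t}} ->
  {in `[0, T] &, {homo n : s t / s <= t}} -> 0 <= n 0 ->
  (forall s, 0 <= s -> s <= T -> B < k s - n s -> P s) ->
  forall t, 0 <= t -> t <= T -> k t - n t <= B.
Proof.
move=> B0 [k0 kI kA] kn nn n0 PB t t0 tT; rewrite leNgt; apply/negP => Bt.
pose E := [set s | [/\ 0 <= s, s <= t & forall u, s <= u -> u <= t -> B < k u - n u]].
have Et : E t by split => // u tu ut; have -> : u = t by apply/le_anti/andP.
have lbE : lbound E 0 by move=> s [].
have hiE : has_inf E by split; [exists t|exists 0].
set s := inf E.
have s0 : 0 <= s by apply: lb_le_inf => //; exists t.
have st : s <= t by apply: ge_inf => //; exists 0.
have sT : s <= T by exact: le_trans tT.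
have inT u v : 0 <= u -> u <= v -> v <= T -> u \in `[0, T] /\ v \in `[0, T].
  by move=> u0 uv vT; rewrite !in_itv/= u0 vT (le_trans u0)// (le_trans uv).
have above u : s < u -> u <= t -> B < k u - n u.
  move=> su ut; have [v [_ _ Ev] vu] := inf_lt hiE.1 su.
  exact/Ev/ut/ltW.
(* If the level is not exceeded at [s], then [k] does not increase over []s, t]], so [k - n] cannot
   exceed [B] at [t]. *)
have [sB|Bs] := lerP (k s - n s) B.
  suff : k t - n t <= k s - n s by lra.
  have [sT' tT'] := inT _ _ s0 st tT.
  rewrite lerB ?nn// kI// => u su ut; apply: PB; last exact: above.
    exact: le_trans (ltW su).
  exact: le_trans tT.
(* An excursion cannot start above [B] at time 0, as [k 0 <= 0 <= n 0]. *)
move: s0; rewrite le_eqVlt => /predU1P[s0|s0].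
  by rewrite -s0 in Bs; have := k0 (PB 0 (lexx _) (le_trans t0 tT) Bs); lra.
(* With the excess over [B] as tolerance, [k v - n s > B]; by monotonicity [k - n] exceeds [B] on
   all of [[v, s]], against the choice of [s]. *)
have [|v [v0 vs kv]] := kA s (k s - n s - B) s0 sT (PB _ (ltW s0) sT Bs).
  by rewrite subr_gt0.
suff /(ge_inf hiE.2) : E v by rewrite leNgt vs.
split => //; first exact: le_trans (ltW vs) st.
move=> u vu ut; have [us|su] := leP u s; last exact: above.
have [vT uT] := inT _ _ v0 vu (le_trans ut tT).
have [_ sT'] := inT _ _ v0 (ltW vs) sT.
have := kn _ _ vT uT vu; have := nn _ _ uT sT' us; lra.
Qed.

(** At time [t] the gap [x - y > e / c] raises [F] by more than [e], which outweighs the change of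
    at most [e] between the times [s] and [t]. *)
Lemma barrier_lt {R : realType} (c e t s x y : R) (F : R -> R -> R) :
  0 < c -> 0 <= e -> {homo F t : x y / x < y} ->
  c * `|x - y| <= `|F t x - F t y| -> `|F t y - F s y| <= e ->
  e / c < x - y -> F s y < F t x.
Proof.
move=> c0 e0 Fincr Flip Fosc exy.
have yx : y < x by rewrite -subr_gt0 (le_lt_trans _ exy)// divr_ge0// ltW.
move: Flip; rewrite !gtr0_norm ?subr_gt0//; last exact: Fincr.
move: exy; rewrite ltr_pdivrMr// mulrC => exy.
by move: Fosc; rewrite ler_norml => /andP[]; lra.
Qed.

Lemma skorokhod_solution_dist_le {R : realType} (c e d T : R)
    (L U : R -> R -> R) (S S' X K X' K' lam : R -> R) :
  0 < c -> 0 <= e -> 0 <= d -> 0 <= T ->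
  (forall t : R, 0 <= t -> {homo L t : x y / x < y}) ->
  (forall t : R, 0 <= t -> {homo U t : x y / x < y}) ->
  (forall t x y : R, 0 <= t -> c * `|x - y| <= `|L t x - L t y|) ->
  (forall t x y : R, 0 <= t -> c * `|x - y| <= `|U t x - U t y|) ->
  (forall s t x, s \in `[0, T] -> t \in `[0, T] -> `|L s x - L t x| <= e) ->
  (forall s t x, s \in `[0, T] -> t \in `[0, T] -> `|U s x - U t x| <= e) ->
  skorokhod_solution L U S X K -> skorokhod_solution L U S' X' K' ->
  time_change T lam ->
  (forall t, t \in `[0, T] -> `|S t - S' (lam t)| <= d) ->
  forall t, t \in `[0, T] -> `|K t - K' (lam t)| <= e / c + d.
Proof.
move=> c0 e0 d0 T0 L_incr U_incr L_lip U_lip L_osc U_osc.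
case=> _ _ XE XB [Kr [Kl [KV KE Kl_int Kr_int]]].
case=> _ _ XE' XB' [Kr' [Kl' [KV' KE' Kl_int' Kr_int']]] lamT Sd.
have B0 : 0 <= e / c + d by rewrite addr_ge0// divr_ge0// ltW.
have mon (f : cumulative R R) : {in `[0, T] &, {homo f : s t / s <= t}}.
  by move=> s t _ _; exact: cumulative_is_nondecreasing.
have monlam (f : cumulative R R) : {in `[0, T] &, {homo f \o lam : s t / s <= t}}.
  move=> s t sT tT st; apply: cumulative_is_nondecreasing.
  exact: (time_change_le lamT).
have monD (f g : R -> R) : {in `[0, T] &, {homo f : s t / s <= t}} ->
    {in `[0, T] &, {homo g : s t / s <= t}} ->
    {in `[0, T] &, {homo (fun s => f s + g s) : s t / s <= t}}.
  by move=> fn gn s t sT tT st; rewrite lerD ?fn ?gn.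
have ge0 (f : cumulative R R) s : (forall t, t < 0 -> f t = 0) -> 0 <= s -> 0 <= f s.
  (* Any negative time would do in place of -1: the value there is 0. *)
  move=> f0 s0; rewrite -(f0 (-1)) ?ltrN10//; apply: cumulative_is_nondecreasing.
  by rewrite (le_trans _ s0)// lerN10.
have KrV t : t < 0 -> Kr t = 0 by move=> /KV[].
have KlV t : t < 0 -> Kl t = 0 by move=> /KV[].
have KrV' t : t < 0 -> Kr' t = 0 by move=> /KV'[].
have KlV' t : t < 0 -> Kl' t = 0 by move=> /KV'[].
have Kr_inert := inert_on_cumulative T KrV Kr_int.
have Kl_inert := inert_on_cumulative T KlV Kl_int.
have Kr_inert' := inert_on_time_change T0 lamT (inert_on_cumulative T KrV' Kr_int').
have Kl_inert' := inert_on_time_change T0 lamT (inert_on_cumulative T KlV' Kl_int').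
have lam_ge0 s : s \in `[0, T] -> 0 <= lam s.
  by move=> /(time_change_in lamT); rewrite in_itv => /andP[].
have inT s : 0 <= s -> s <= T -> s \in `[0, T] by move=> s0 sT; rewrite in_itv/= s0.
move=> t tT; move: (tT); rewrite in_itv/= => /andP[t0 tleT].
rewrite ler_norml; apply/andP; split.
(* [K' \o lam - K] is regrouped as a difference of nondecreasing functions; only the first group has
   to be inert. *)
- suff : (Kr' (lam t) + Kl t) - (Kl' (lam t) + Kr t) <= e / c + d.
    by rewrite KE// KE' ?lam_ge0//; lra.
  apply: (le_of_inert_on B0 (inert_onD (monlam _) (mon _) Kr_inert' Kl_inert)
    (monD _ _ (monlam _) (mon _)) (monD _ _ (monlam _) (mon _)) _ _ t0 tleT).
    by rewrite /= (time_change0 T0 lamT) addr_ge0// ge0.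
  move=> s s0 sT; have sT' := inT _ s0 sT; have ls0 := lam_ge0 _ sT'.
  have lsT := time_change_in lamT sT'.
  move=> /= Bs; have := Sd _ sT'; rewrite ler_norml => /andP[Sd1 Sd2].
  (* The inputs differ by at most [d], which leaves [e / c] of the excess for the solutions. *)
  have xy : e / c < X' (lam s) - X s by rewrite XE// XE'// KE// KE'//; lra.
  have /andP[Ls Us] := XB _ s0; have /andP[Ls' Us'] := XB' _ ls0; split => /=.
    apply: le_lt_trans Us _.
    exact: barrier_lt c0 e0 (U_incr _ ls0) (U_lip _ _ _ ls0) (U_osc _ _ _ lsT sT') xy.
  apply: lt_le_trans Ls'.
  exact: barrier_lt c0 e0 (L_incr _ ls0) (L_lip _ _ _ ls0) (L_osc _ _ _ lsT sT') xy.
- suff : (Kr t + Kl' (lam t)) - (Kl t + Kr' (lam t)) <= e / c + d.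
    by rewrite KE// KE' ?lam_ge0//; lra.
  apply: (le_of_inert_on B0 (inert_onD (mon _) (monlam _) Kr_inert Kl_inert')
    (monD _ _ (mon _) (monlam _)) (monD _ _ (mon _) (monlam _)) _ _ t0 tleT).
    by rewrite /= (time_change0 T0 lamT) addr_ge0// ge0.
  move=> s s0 sT; have sT' := inT _ s0 sT; have ls0 := lam_ge0 _ sT'.
  have lsT := time_change_in lamT sT'.
  move=> /= Bs; have := Sd _ sT'; rewrite ler_norml => /andP[Sd1 Sd2].
  have xy : e / c < X s - X' (lam s) by rewrite XE// XE'// KE// KE'//; lra.
  have /andP[Ls Us] := XB _ s0; have /andP[Ls' Us'] := XB' _ ls0; split => /=.
    apply: le_lt_trans Us' _.
    exact: barrier_lt c0 e0 (U_incr _ s0) (U_lip _ _ _ s0) (U_osc _ _ _ sT' lsT) xy.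
  apply: lt_le_trans Ls.
  exact: barrier_lt c0 e0 (L_incr _ s0) (L_lip _ _ _ s0) (L_osc _ _ _ sT' lsT) xy.
Qed.

(** * Oscillations, the J1 distance and the infimum over time changes *)

Lemma time_osc_ge0 {R : realType} (T : R) (F : R -> R -> R) :
  0 <= T -> (0 <= time_osc T F)%E.
Proof.
move=> T0; apply: le_ereal_sup_tmp; exists 0%E => //.
exists 0, 0, 0; rewrite subrr normr0; split => //; by rewrite in_itv/= lexx.
Qed.

Lemma J1_dist_ge0 {R : realType} (T : R) (f g : R -> R) :
  0 <= T -> (0 <= J1_dist T f g)%E.
Proof.
move=> T0; apply: le_ereal_inf_tmp => _ [lam lamT <-].
rewrite le_max; apply/orP; left; apply: le_ereal_sup_tmp.
exists (`|lam 0 - 0|)%:E; last by rewrite lee_fin.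
by exists 0 => //=; rewrite in_itv/= lexx.
Qed.

Lemma J1_dist_lt {R : realType} (T d : R) (f g : R -> R) :
  (J1_dist T f g < d%:E)%E ->
  exists lam, [/\ time_change T lam,
    forall t, t \in `[0, T] -> `|lam t - t| <= d &
    forall t, t \in `[0, T] -> `|f t - g (lam t)| <= d].
Proof.
move=> /ereal_inf_lt[_ [lam lamT <-]]; rewrite gt_max => /andP[lam1 lam2].
exists lam; split => // t tT; rewrite -lee_fin.
  by apply: le_trans (ltW lam1); apply: ereal_sup_ubound; exists t.
by apply: le_trans (ltW lam2); apply: ereal_sup_ubound; exists t.
Qed.

Lemma J1_dist_le {R : realType} (T d : R) (f g lam : R -> R) :
  time_change T lam ->
  (forall t, t \in `[0, T] -> `|lam t - t| <= d) ->
  (forall t, t \in `[0, T] -> `|f t - g (lam t)| <= d) ->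
  (J1_dist T f g <= d%:E)%E.
Proof.
move=> lamT lamd fgd; apply: ge_ereal_inf; eexists; first by exists lam.
rewrite ge_max; apply/andP; split; apply: ge_ereal_sup => _ [t tT <-].
  by rewrite lee_fin lamd.
by rewrite lee_fin fgd.
Qed.

Theorem proposition3p16 (R : realType) (c C : R) (hc : 0 < c) (hcC : c < C)
  (L U : R -> R -> R)
  (L_cadlag : forall x : R, cadlag (fun t => L t x))
  (U_cadlag : forall x : R, cadlag (fun t => U t x))
  (L_incr : forall t : R, 0 <= t -> {homo L t : x y / x < y})
  (U_incr : forall t : R, 0 <= t -> {homo U t : x y / x < y})
  (L_lip : forall t x y : R, 0 <= t ->
     c * `|x - y| <= `|L t x - L t y| <= C * `|x - y|)
  (U_lip : forall t x y : R, 0 <= t ->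
     c * `|x - y| <= `|U t x - U t y| <= C * `|x - y|)
  (LU_gap : (0 < ereal_inf [set z : \bar R | exists t x : R,
     (0 <= t)%R /\ z = (U t x - L t x)%:E])%E)
  (S S' X K X' K' : R -> R)
  (hS : cadlag S) (hS' : cadlag S')
  (hXK : skorokhod_solution L U S X K)
  (hXK' : skorokhod_solution L U S' X' K')
  (T : R) (hT : 0 < T) :
  (J1_dist T K K' <=
     (c^-1)%:E * maxe (time_osc T L) (time_osc T U)
     + (C / c)%:E * J1_dist T S S')%E.
Proof.
have T0 := ltW hT; have C0 : 0 < C := lt_trans hc hcC.
have m0 : (0 <= maxe (time_osc T L) (time_osc T U))%E.
  by rewrite le_max time_osc_ge0.
have J0 := J1_dist_ge0 S S' T0.
have osc F e s t x : (time_osc T F <= e%:E)%E -> s \in `[0, T] -> t \in `[0, T] ->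
    `|F s x - F t x| <= e.
  move=> Fe sT tT; rewrite -lee_fin; apply: le_trans Fe.
  by apply: ereal_sup_ubound; exists s, t, x.
(* An infinite oscillation makes the right-hand side infinite, as its other term is nonnegative. *)
move: m0; case mE : (maxe _ _) => [e| |] //; rewrite ?lee_fin => e0; last first.
  rewrite gt0_muley ?lte_fin ?invr_gt0// addye ?leey//.
  by rewrite gt_eqF// (lt_le_trans ltNy0)// mule_ge0// lee_fin divr_ge0// ltW.
have [Le Ue] : (time_osc T L <= e%:E)%E /\ (time_osc T U <= e%:E)%E.
  by split; rewrite -mE le_max lexx ?orbT.
move: J0; case JE : (J1_dist T S S') => [d| |] //; rewrite ?lee_fin => d0; last first.
  by rewrite gt0_muley ?lte_fin ?divr_gt0// addey ?leey.
rewrite -!EFinM -EFinD; apply/lee_addgt0Pr => r r0; rewrite -EFinD.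
(* The infimum need not be attained; the slack is chosen so that multiplication by [C / c] turns it
   into [r]. *)
have [|lam [lamT lamd Sd]] := @J1_dist_lt _ T (d + r * (c / C)) S S'.
  by rewrite JE lte_fin ltrDl mulr_gt0// divr_gt0.
set d' := d + r * (c / C) in lamd Sd.
have d'0 : 0 <= d' by rewrite addr_ge0// mulr_ge0 ?divr_ge0// ltW.
have dE : C / c * d' = C / c * d + r.
  by rewrite /d'; field; rewrite !gt_eqF.
(* As [C / c >= 1], the bound covers both the time displacement [d'] and the term [d'] in the
   distance of [K] and [K' \o lam]. *)
have d'C : d' <= C / c * d' by rewrite ler_peMl// ler_pdivlMr// mul1r ltW.
have ec0 : 0 <= c^-1 * e by rewrite mulr_ge0// invr_ge0 ltW.
apply: (J1_dist_le lamT) => t tT; first by have := lamd _ tT; lra.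
have := skorokhod_solution_dist_le hc e0 d'0 T0 L_incr U_incr
  (fun t x y t0 => (andP (L_lip t x y t0)).1) (fun t x y t0 => (andP (U_lip t x y t0)).1)
  (fun s t x => osc L e s t x Le) (fun s t x => osc U e s t x Ue) hXK hXK' lamT Sd tT.
by rewrite mulrC; lra.
Qed.
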